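(* For each even integer $d \ge 4$, there exist infinitely many (pairwise non-isomorphic) $d$-regular Cayley nut graphs.
   Context: All graphs are finite and simple. A nut graph is a graph $G$ whose adjacency matrix $A(G)$ has nullity exactly $1$ and such that a non-zero vector spanning $\ker A(G)$ has no zero entries. Given a finite group $\Gamma$ with identity $e$ and a subset $C \subseteq \Gamma\setminus\{e\}$ closed under inversion, $\mathrm{Cay}(\Gamma, C)$ is the graph with vertex set $\Gamma$ in which $u$ and $v$ are adjacent iff $vu^{-1}\in C$. A Cayley graph is any graph isomorphic to $\mathrm{Cay}(\Gamma,C)$ for some finite group $\Gamma$ and some such $C$. *)

(* Defs.v *)
From mathcomp Require Import all_boot all_order all_algebra all_fingroup.
Set Implicit Arguments.
Unset Strict Implicit.
Unset Printing Implicit Defensive.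
Import GRing.Theory.
Local Open Scope ring_scope.

Record sgraph := SGraph {
  vertex :> finType;
  adj : rel vertex;
  adj_sym : symmetric adj;
  adj_irr : irreflexive adj
}.

Definition graph_iso (G H : sgraph) : Prop :=
  exists f : G -> H, bijective f /\ forall x y : G, adj (f x) (f y) = adj x y.

Definition regular (d : nat) (G : sgraph) : Prop :=
  forall v : G, #|[set w : G | adj v w]| = d.

(* Vertices are numbered by the enumeration of the vertex type. *)
Definition adj_mx (R : realFieldType) (G : sgraph) : 'M[R]_#|G| :=
  \matrix_(i, j) (adj (enum_val i) (enum_val j))%:R.

(* The columns of cokermx A span the kernel {x | A *m x = 0}, whereas
   the rows of kermx A span the left kernel. *)
Definition nullity (F : fieldType) (n : nat) (A : 'M[F]_n) : nat :=
  \rank (cokermx A).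

(* Since the nullity is 1, the non-zero vectors of the kernel are exactly the
   vectors spanning it. *)
Definition nut_graph (R : realFieldType) (G : sgraph) : Prop :=
  nullity (adj_mx R G) = 1%N /\
  forall x : 'cV[R]_#|G|, adj_mx R G *m x = 0 -> x != 0 ->
    forall i, x i 0 != 0.

Section Cayley.
Local Open Scope group_scope.
Variables (gT : finGroupType) (C : {set gT}).
Hypotheses (C1 : 1 \notin C) (CV : forall x, x \in C -> x^-1 \in C).

Definition cay_adj : rel gT := fun u v => v * u^-1 \in C.

Lemma cay_adj_sym : symmetric cay_adj.
Proof.
have sub u v : cay_adj u v -> cay_adj v u by move/CV; rewrite invMg invgK.
by move=> u v; apply/idP/idP; apply: sub.
Qed.

Lemma cay_adj_irr : irreflexive cay_adj.
Proof. by move=> u; rewrite /cay_adj mulgV; apply/negbTE. Qed.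

Definition Cay : sgraph := SGraph cay_adj_sym cay_adj_irr.
End Cayley.

Definition cayley_graph (G : sgraph) : Prop :=
  exists (gT : finGroupType) (C : {set gT}) (C1 : 1%g \notin C)
         (CV : forall x, x \in C -> x^-1%g \in C),
    graph_iso G (Cay C1 CV).

(* Main.v *)
(* The graphs are Cayley graphs of Z_2 x Z_2 x Z_p for large primes p. With
   h = d / 2, the connection set is S over (0, 1), the single element 0 over
   (1, 0) and S' over (1, 1), where S and S' are symmetric subsets of Z_p with
   h and h - 1 elements. The kernel splits along the four characters of
   Z_2 x Z_2, each of which leaves a convolution equation on Z_p. For three
   characters the coefficients of the convolution add up to 2h, 2 - 2h or -2;
   these are non-zero modulo p, which makes the convolution invertible. For the
   character (e1, e2) |-> (-1)^e1 the coefficients add up to 0, and S and S' are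
   chosen so that the convolution is, up to sign,
   T^a + T^-a - T^b - T^-b = T^-a (T^(a-b) - 1) (T^(a+b) - 1), with T the
   translation by 1, whose kernel consists of the constants. *)

Require Import Defs.
From mathcomp Require Import all_boot all_order all_algebra all_fingroup.
From mathcomp Require Import alt ring lra zify.
Set Implicit Arguments.
Unset Strict Implicit.
Unset Printing Implicit Defensive.
Import GRing.Theory Num.Theory.
Local Open Scope ring_scope.

(** * Nut graphs through functions on the vertices *)

Section NutCriterion.
Variables (R : realFieldType) (G : sgraph).

Lemma adj_mx_kerP (x : 'cV[R]_#|G|) :
  adj_mx R G *m x = 0 <->
  forall u : G, \sum_(w | adj u w) x (enum_rank w) 0 = 0.
Proof.
have E u : (adj_mx R G *m x) (enum_rank u) 0
           = \sum_(w | adj u w) x (enum_rank w) 0.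
  rewrite mxE (reindex enum_rank) /=; last first.
    by exists enum_val => j _; rewrite ?enum_rankK ?enum_valK.
  rewrite [RHS]big_mkcond /=; apply: eq_bigr => w _.
  by rewrite mxE !enum_rankK; case: adj; rewrite ?mul1r ?mul0r.
split=> [Ax0 u|x0]; first by rewrite -E Ax0 mxE.
by apply/matrixP=> i j; rewrite ord1 -[i]enum_valK E x0 mxE.
Qed.

Lemma nut_graphP (v : G -> R) (u0 : G) :
    (forall u, v u != 0) -> (forall u, \sum_(w | adj u w) v w = 0) ->
    (forall x : G -> R, (forall u, \sum_(w | adj u w) x w = 0) ->
       exists c, forall u, x u = c * v u) ->
  nut_graph R G.
Proof.
move=> v_neq0 v_ker ker_v.
pose y : 'cV[R]_#|G| := \col_i v (enum_val i).
have Ay : adj_mx R G *m y = 0.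
  apply/adj_mx_kerP => u; rewrite -[RHS](v_ker u).
  by apply: eq_bigr => w _; rewrite mxE enum_rankK.
have kerE (x : 'cV[R]_#|G|) : adj_mx R G *m x = 0 -> exists c, x = c *: y.
  move/adj_mx_kerP=> /(ker_v (fun w => x (enum_rank w) 0))[c xE].
  exists c; apply/matrixP=> i j.
  by rewrite ord1 -[i]enum_valK xE !mxE enum_rankK.
split; last first.
  move=> x /kerE[c ->]; rewrite scaler_eq0 negb_or => /andP[c0 _] i.
  by rewrite !mxE mulf_neq0.
(* Every column of [cokermx] lies in the kernel, hence is a multiple of [y]; the matrix thus factors
   as a column times a row and has rank at most 1. *)
apply/eqP; rewrite /nullity eqn_leq; apply/andP; split.
  have: adj_mx R G *m cokermx (adj_mx R G) = 0 by rewrite mulmx_coker.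
  move: (cokermx _) => K AK.
  have colK j : exists c, col j K == c *: y.
    have [|c ->] := kerE (col j K); last by exists c.
    by rewrite colE mulmxA AK mul0mx.
  pose r : 'rV[R]_#|G| := \row_j xchoose (colK j).
  suff -> : K = y *m r.
    by rewrite (leq_trans (mxrankM_maxr _ _)) // rank_leq_row.
  apply/matrixP=> i j; rewrite [RHS]mxE big_ord1.
  have /eqP/matrixP/(_ i 0) := xchooseP (colK j).
  by rewrite !mxE => ->; rewrite mulrC.
(* Nullity 0 would give a left inverse and force [y] = 0, which fails at the vertex [u0]. *)
rewrite lt0n mxrank_eq0; apply: contraTneq isT => cok0.
have /row_fullP[B BA] : row_full (adj_mx R G).
  by rewrite -cokermx_eq0 cok0.
have /matrixP/(_ (enum_rank u0) 0) : y = 0.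
  by rewrite -[y]mul1mx -BA -mulmxA Ay mulmx0.
by rewrite !mxE => /eqP; rewrite (negPf (v_neq0 _)).
Qed.

End NutCriterion.

(** * Convolution equations and symmetric subsets on Z_p *)

Section PrimeCycle.
Variables (p : nat) (p_pr : prime p).

Lemma natFp_neq0 n : (0 < n < p)%N -> n%:R != 0 :> 'F_p.
Proof.
by case/andP=> n0 np; rewrite -(dvdn_pcharf (pchar_Fp p_pr)) gtnNdvd.
Qed.

Lemma Fp_neq_opp (k : 'F_p) : (2 < p)%N -> k != 0 -> k != - k.
Proof.
move=> p2 k0; rewrite -subr_eq0 opprK -mulr2n -mulr_natr mulf_neq0 //.
exact: natFp_neq0.
Qed.

(** Translation by 1 on functions on Z_p. The size is that of the ordinal type underlying ['F_p], so
    residues index rows and columns directly. *)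
Definition shift_mx (K : pzSemiRingType) : 'M[K]_((Zp_trunc (pdiv p)).+2) :=
  \matrix_(k, l) (l == k + 1)%:R.

Lemma shift_mxX (K : pzSemiRingType) n :
  shift_mx K ^+ n = \matrix_(k, l) (l == k + n%:R)%:R.
Proof.
elim: n => [|n IHn]; apply/matrixP => k l.
  by rewrite expr0 !mxE addr0 eq_sym.
rewrite exprS IHn -mulmxE !mxE (bigD1 (k + 1)) //= !mxE eqxx mul1r.
rewrite big1 ?addr0 => [|j /negPf jk]; last by rewrite !mxE jk mul0r.
by rewrite -addrA nat1r.
Qed.

Lemma shift_mx_Fp (K : pzSemiRingType) : shift_mx K ^+ p = 1.
Proof.
rewrite shift_mxX; apply/matrixP => k l.
by rewrite (pcharf0 (pchar_Fp p_pr)) !mxE addr0 eq_sym.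
Qed.

(* Modulo p, Frobenius gives (\sum_i a_i T^i)^p = \sum_i a_i. *)
Lemma det_circulant_neq0 (a : 'F_p -> int) :
  (\sum_i a i)%:~R != 0 :> 'F_p ->
  \det (\sum_i a i *: shift_mx int ^+ i) != 0.
Proof.
move=> sa; apply: contraNneq sa => det0.
(* Frobenius requires a commutative ring, so the p-th power is computed on a polynomial, which is
   then evaluated at the shift matrix. *)
pose f : {poly 'F_p} := \sum_i (a i)%:~R *: 'X^i.
pose M := horner_mx (shift_mx 'F_p) f.
have ME : M = map_mx intr (\sum_i a i *: shift_mx int ^+ i).
  rewrite /M /f !rmorph_sum; apply: eq_bigr => i _ /=.
  rewrite map_mxZ linearZ /= rmorphXn /= horner_mx_X; congr (_ *: _).
  rewrite !shift_mxX; apply/matrixP=> k l; rewrite !mxE.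
  by case: eqP.
have detM : \det M = 0 by rewrite ME det_map_mx det0.
have pX : p \in [pchar {poly 'F_p}] by rewrite pchar_lalg pchar_Fp.
have Mp : M ^+ p = ((\sum_i a i)%:~R ^+ p)%:M.
  rewrite -rmorphXn /= -(pFrobenius_autE pX) rmorph_sum /=.
  rewrite -(pFrobenius_autE (pchar_Fp p_pr)) !rmorph_sum /=.
  apply: eq_bigr => i _; rewrite !pFrobenius_autE exprZn linearZ /=.
  rewrite -exprM mulnC exprM !rmorphXn /= horner_mx_X shift_mx_Fp expr1n.
  by rewrite scalemx1 rmorphXn.
have detMX n : \det (M ^+ n.+1) = 0.
  by rewrite exprS -mulmxE det_mulmx detM mul0r.
have := detMX p.-1; rewrite prednK ?prime_gt0 //.
by rewrite Mp det_scalar => /eqP; rewrite !expf_eq0 /= => /andP[_ ->].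
Qed.

Variable R : realFieldType.

(** The circulant matrix has a non-zero integer determinant, which stays non-zero in [R] because [R]
    has characteristic 0. *)
Lemma circulant_inj (a : 'F_p -> int) (g : 'F_p -> R) :
  (\sum_i a i)%:~R != 0 :> 'F_p ->
  (forall k, \sum_i (a i)%:~R * g (k + i) = 0) -> forall k, g k = 0.
Proof.
move=> /det_circulant_neq0 det_neq0 ag0 k.
pose M := map_mx (intr : int -> R) (\sum_i a i *: shift_mx int ^+ i).
have M_unit : M \in unitmx by rewrite unitmxE det_map_mx unitfE intr_eq0.
pose y : 'cV[R]_((Zp_trunc (pdiv p)).+2) := \col_i g i.
suff My : M *m y = 0.
  have /matrixP/(_ k 0) : y = 0 by rewrite -(mulKmx M_unit y) My mulmx0.
  by rewrite !mxE.
apply/matrixP=> i j; rewrite !mxE -[RHS](ag0 i).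
rewrite (reindex (fun l : 'F_p => i + l)) /=; last first.
  by exists (fun l => l - i) => l _; rewrite addrC ?subrK ?addKr ?addrK //.
apply: eq_bigr => l _; rewrite !mxE; congr (_ * _).
rewrite summxE (bigD1 l) //= big1 ?addr0 => [|m ml]; rewrite mxE shift_mxX mxE.
  by rewrite natr_Zp eqxx mulr1.
by rewrite natr_Zp (inj_eq (addrI i)) eq_sym (negPf ml) mulr0.
Qed.

(** A non-zero [a] generates the additive group Z_p: [k] is the multiple of [a] by [k / a]. *)
Lemma shift_invariant_const (g : 'F_p -> R) (a : 'F_p) :
  a != 0 -> (forall k, g (k + a) = g k) -> forall k, g k = g 0.
Proof.
move=> a0 ga k.
have gn n : g (a *+ n) = g 0.
  by elim: n => [|n IHn]; rewrite ?mulr0n // mulrSr ga.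
by rewrite -(gn (k / a)) -mulr_natr natr_Zp mulrC divfK.
Qed.

(** The difference of [g] along [a + b] is invariant under [a - b], hence constant. Its sum over Z_p
    is 0, so the constant vanishes and [g] is invariant under [a + b]. *)
Lemma second_difference_const (g : 'F_p -> R) (a b : 'F_p) :
  a - b != 0 -> a + b != 0 ->
  (forall k, g (k + a) + g (k - a) = g (k + b) + g (k - b)) ->
  forall k, g k = g 0.
Proof.
move=> amb apb gab; apply: (shift_invariant_const apb) => k.
pose u k := g (k + (a + b)) - g k.
have uc := @shift_invariant_const u _ amb _.
have {}uc : forall k, u k = u 0.
  apply: uc => j; rewrite /u.
  have := gab (j + a).
  have -> : j + a + a = j + (a - b) + (a + b) by ring.
  have -> : j + a - a = j by ring.
  have -> : j + a + b = j + (a + b) by ring.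
  have -> : j + a - b = j + (a - b) by ring.
  lra.
have : \sum_k u k = 0.
  rewrite sumrB; apply/eqP; rewrite subr_eq0; apply/eqP.
  rewrite [RHS](reindex (fun l : 'F_p => l + (a + b))) //=.
  by exists (fun l => l - (a + b)) => l _; rewrite ?subrK ?addrK.
rewrite (eq_bigr _ (fun k _ => uc k)) sumr_const => /eqP.
rewrite mulrn_eq0 card_ord /= => /eqP u0.
by have := uc k; rewrite u0 /u => /eqP; rewrite subr_eq0 => /eqP.
Qed.

(** Pairs [k], [- k] outside [Z] are added one at a time; they are true pairs since [p] is odd and 0
    is in [Z]. The boolean conclusion allows a witness to be extracted by [sigW]. *)
Lemma symmetric_set_exists (Z : {set 'F_p}) n :
    (2 < p)%N -> 0 \in Z -> {in Z, forall k, - k \in Z} ->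
    (n.*2 + #|Z| <= p)%N ->
  exists D : {set 'F_p},
    [&& [forall k in D, - k \in D], [disjoint D & Z] & #|D| == n.*2].
Proof.
move=> p2 Z0 ZN; elim: n => [|n IHn] le_np.
  exists set0; rewrite cards0 eqxx -setI_eq0 set0I eqxx !andbT.
  by apply/'forall_implyP=> k; rewrite inE.
have [|D /and3P[/'forall_implyP DN DZ /eqP D_card]] := IHn.
  by apply: leq_trans le_np; rewrite leq_add2r leq_double.
have [k kDZ] : exists k, k \notin D :|: Z.
  apply/existsP; rewrite -negb_forall; apply/negP=> /forallP DZT.
  have : #|[set: 'F_p]| = p by rewrite cardsT card_Fp.
  have -> : [set: 'F_p] = D :|: Z by apply/setP=> k; rewrite DZT inE.
  by rewrite cardsU (disjoint_setI0 DZ) cards0 D_card; lia.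
move: kDZ; rewrite inE negb_or => /andP[kD kZ].
have k_neq0 : k != 0 by apply: contraNneq kZ => ->.
have kNk : k != - k by apply: Fp_neq_opp.
have NkD : - k \notin D by apply: contra kD => /DN; rewrite opprK.
have NkZ : - k \notin Z by apply: contra kZ => /ZN; rewrite opprK.
exists (k |: (- k |: D)); apply/and3P; split.
- apply/'forall_implyP=> j; rewrite !inE => /or3P[/eqP->|/eqP->|/DN ->].
  + by rewrite eqxx orbT.
  + by rewrite opprK eqxx.
  + by rewrite !orbT.
- rewrite disjoints_subset; apply/subsetP=> j.
  rewrite !inE => /or3P[/eqP->|/eqP->|/(disjointFr DZ)->] //.
- by rewrite !cardsU1 D_card !inE negb_or kNk kD NkD doubleS.
Qed.
End PrimeCycle.

(** * The Cayley graph on Z_2 x Z_2 x Z_p and its kernel *)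

Section Construction.
Variables (p : nat) (p_pr : prime p) (S S' : {set 'F_p}).

Let gT : finGroupType := (bool * bool * 'F_p)%type.

Definition connection : {set gT} :=
  [set c | let: (e1, e2, k) := c in
    if e1 then if e2 then k \in S' else k == 0 else e2 && (k \in S)].

Lemma big_connection (V : nmodType) (F : gT -> V) :
  \sum_(c in connection) F c =
    \sum_(k in S) F (false, true, k) + F (true, false, 0)
    + \sum_(k in S') F (true, true, k).
Proof.
pose F' c := if c \in connection then F c else 0.
transitivity (\sum_e1 \sum_e2 \sum_k F' (e1, e2, k)).
  by rewrite big_mkcond !pair_bigA; apply: eq_bigr => -[[]].
rewrite !big_bool /= /F'.
rewrite [X in _ + (_ + X)]big1 => [|k _]; last by rewrite inE.
rewrite addr0 addrC [X in _ + X]addrC addrA; congr (_ + _ + _).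
- by rewrite [RHS]big_mkcond; apply: eq_bigr => k _; rewrite inE.
- rewrite (bigD1 0) //= inE eqxx big1 ?addr0 // => k /negPf k0.
  by rewrite inE k0.
- by rewrite [RHS]big_mkcond; apply: eq_bigr => k _; rewrite inE.
Qed.

Lemma connection1 : (1%g : gT) \notin connection. Proof. by rewrite inE. Qed.

Hypotheses (SN : {in S, forall k, - k \in S})
           (S'N : {in S', forall k, - k \in S'}).

Lemma connectionV x : x \in connection -> x^-1%g \in connection.
Proof.
case: x => [[[] []] k]; rewrite !inE //=; first exact: S'N.
- by move/eqP->; apply/eqP; exact: oppr0.
- exact: SN.
Qed.

Let G := Cay connection1 connectionV.

Lemma sum_adj_connection (V : nmodType) (x : G -> V) e1 e2 (k : 'F_p) :
  \sum_(w | @adj G (e1, e2, k) w) x w =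
    \sum_(i in S) x (e1, ~~ e2, k + i) + x (~~ e1, e2, k)
    + \sum_(i in S') x (~~ e1, ~~ e2, k + i).
Proof.
rewrite (reindex (fun c : gT => c * (e1, e2, k))%g) /=; last first.
  by exists (fun c => c * (e1, e2, k)^-1)%g => c _; rewrite ?mulgK ?mulgKV.
transitivity (\sum_(c in connection) x (c * (e1, e2, k))%g).
  by apply: eq_bigl => c; rewrite /cay_adj mulgK.
rewrite big_connection; congr (_ + _ + _).
- by apply: eq_bigr => i _; congr (x (_, _, _)); rewrite addrC.
- by congr (x (_, _, _)); exact: add0r.
- by apply: eq_bigr => i _; congr (x (_, _, _)); rewrite addrC.
Qed.

Lemma regular_connection : regular (#|S| + #|S'|).+1 G.
Proof.
case=> [[e1 e2] k]; rewrite -sum1_card.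
under eq_bigl do rewrite inE.
rewrite (sum_adj_connection (V := nat) (fun=> 1%N)) !sum1_card.
by rewrite addrAC; exact: addn1.
Qed.

Variable R : realFieldType.
Variable h : nat.
Hypotheses (h_gt1 : (1 < h)%N) (h_lt : (h.*2 < p)%N).
Hypotheses (S_card : #|S| = h) (S'_card : #|S'| = h.-1).
Hypothesis chi_ker : forall g : 'F_p -> R,
  (forall k, \sum_(i in S) g (k + i) = g k + \sum_(i in S') g (k + i)) ->
  forall k, g k = g 0.

(** The three terms merge into one convolution by a weighted sum of the indicators of [S], 0 and
    [S'], which may overlap. Its coefficients add up to the integer in the hypothesis. *)
Lemma isotypic_inj (a b c : int) (g : 'F_p -> R) :
  (a * h%:Z + b + c * h.-1%:Z)%:~R != 0 :> 'F_p ->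
  (forall k, a%:~R * (\sum_(i in S) g (k + i)) + b%:~R * g k
     + c%:~R * (\sum_(i in S') g (k + i)) = 0) ->
  forall k, g k = 0.
Proof.
move=> abc g0.
pose f (i : 'F_p) : int :=
  a * (i \in S)%:R + b * (i == 0)%:R + c * (i \in S')%:R.
apply: (@circulant_inj p p_pr R f) => [|k].
  suff -> : \sum_i f i = a * h%:Z + b + c * h.-1%:Z by [].
  rewrite !big_split /= -!mulr_sumr -!natr_sum -S'_card -S_card.
  have EA (A : {set 'F_p}) : (\sum_i (i \in A) = #|A|)%N.
    rewrite -sum1_card [RHS]big_mkcond.
    by apply: eq_bigr => i _; case: (_ \in _).
  rewrite !EA !natz; congr (_ + _ + _).
  rewrite (bigD1 0) //= big1 ?mulr1 // => i /negPf->//.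
rewrite -[RHS](g0 k) !mulr_sumr.
have EA (A : {set 'F_p}) z :
    \sum_(i in A) z * g (k + i) = \sum_i z * (i \in A)%:R * g (k + i).
  rewrite big_mkcond; apply: eq_bigr => i _.
  by case: (_ \in _); rewrite ?mulr1 ?mulr0 ?mul0r.
rewrite !EA.
have -> : b%:~R * g k = \sum_i b%:~R * (i == 0)%:R * g (k + i).
  rewrite (bigD1 0) //= big1 ?mulr1 ?addr0 // => i /negPf->//.
  by rewrite mulr0 mul0r.
rewrite -!big_split; apply: eq_bigr => i _ /=.
by rewrite /f !rmorphD !rmorphM /= !mulrDl !mulrz_nat.
Qed.

Lemma nut_connection : nut_graph R G.
Proof.
pose v (u : G) : R := (-1) ^+ u.1.1.
apply: (@nut_graphP R G v (1%g : gT)).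
- by move=> u; rewrite signr_eq0.
- move=> [[e1 e2] k].
  rewrite sum_adj_connection /v /= !sumr_const S_card S'_card.
  (* The [h] neighbours over (0, 1) have the sign of the vertex, the other 1 + (h - 1) the opposite
     one. *)
  rewrite -addrA -mulrS prednK ?(ltnW h_gt1) //.
  by case: e1; rewrite -mulrnDl ?addNr ?subrr mul0rn.
move=> x x0.
pose y e1 e2 k := x (e1, e2, k).
have {x0} y0 e1 e2 k : \sum_(i in S) y e1 (~~ e2) (k + i) + y (~~ e1) e2 k
    + \sum_(i in S') y (~~ e1) (~~ e2) (k + i) = 0.
  by rewrite -sum_adj_connection x0.
pose y0k k :=
  (y0 false false k, y0 false true k, y0 true false k, y0 true true k).
(* [F1], [F2], [F3] and [g] are the components for the trivial character, (-1)^e2, (-1)^(e1 + e2)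
   and (-1)^e1. The signs of a character at (0, 1), (1, 0), (1, 1) are the coefficients passed to
   [isotypic_inj]. *)
have F1 : forall k,
    y false false k + y false true k + y true false k + y true true k = 0.
  apply: (@isotypic_inj 1 1 1).
    have -> : (1 * h%:Z + 1 + 1 * h.-1%:Z) = h.*2%:Z by lia.
    by apply: natFp_neq0; lia.
  move=> k; have := y0k k.
  rewrite /= !big_split /=; case=> [[[]]]; lra.
have F2 : forall k,
    y false false k - y false true k + y true false k - y true true k = 0.
  apply: (@isotypic_inj (-1) 1 (-1)).
    have -> : (-1 * h%:Z + 1 + -1 * h.-1%:Z) = - (h.*2.-2)%:Z by lia.
    by rewrite rmorphN oppr_eq0; apply: natFp_neq0; lia.
  move=> k; have := y0k k.
  rewrite /= !big_split !sumrN /=; case=> [[[]]]; lra.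
have F3 : forall k,
    y false false k - y false true k - y true false k + y true true k = 0.
  apply: (@isotypic_inj (-1) (-1) 1).
    have -> : (-1 * h%:Z + -1 + 1 * h.-1%:Z) = - 2%:Z by lia.
    by rewrite rmorphN oppr_eq0; apply: natFp_neq0; lia.
  move=> k; have := y0k k.
  rewrite /= !big_split !sumrN /=; case=> [[[]]]; lra.
pose g k := y false false k + y false true k - y true false k - y true true k.
have gc : forall k, g k = g 0.
  apply: chi_ker => k.
  have := y0k k.
  rewrite /g /= !big_split !sumrN /=; case=> [[[]]]; lra.
(* Fourier inversion on Z_2 x Z_2, a group of order 4: only the component [g] survives. *)
exists (g 0 / 4%:R); case=> [[e1 e2] k].
have := (gc k, F1 k, F2 k, F3 k); rewrite -(gc k) -/(y e1 e2 k) /v /g.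
by case: e1; case: e2 => /=; rewrite ?expr1 ?expr0; case=> [[[]]]; lra.
Qed.

End Construction.

(** * Choice of the two symmetric sets, and the resulting graphs *)

Section Existence.
Variables (p : nat) (p_pr : prime p) (R : realFieldType).

(** Both sets share a symmetric part [D] of even size avoiding 0, 1, -1, 2, -2, which cancels in the
    equation. The few remaining elements fix the parities of the sizes and leave a second difference
    equation. *)
Lemma connection_sets h : (1 < h)%N -> (h.*2 + 5 < p)%N ->
  {SS : {set 'F_p} * {set 'F_p} |
   [/\ {in SS.1, forall k, - k \in SS.1}, {in SS.2, forall k, - k \in SS.2},
       #|SS.1| = h, #|SS.2| = h.-1 &
       forall g : 'F_p -> R,
         (forall k, \sum_(i in SS.1) g (k + i)
                    = g k + \sum_(i in SS.2) g (k + i)) ->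
         forall k, g k = g 0]}.
Proof.
move=> h1 hp.
have n1 : 1 != 0 :> 'F_p by exact: oner_neq0.
have n2 : 2%:R != 0 :> 'F_p by apply: natFp_neq0; lia.
have o1 : 1 != -1 :> 'F_p by apply: Fp_neq_opp; lia.
have o2 : 2%:R != - 2%:R :> 'F_p by apply: Fp_neq_opp => //; lia.
have n3 : 3%:R != 0 :> 'F_p by apply: natFp_neq0; lia.
pose Z : {set 'F_p} := [set 0; 1; -1; 2%:R; - 2%:R].
have Z_card : (#|Z| <= 5)%N.
  have cardU1 (A : {set 'F_p}) k : (#|A :|: [set k]| <= #|A|.+1)%N.
    by rewrite setUC cardsU1; case: (k \notin A) => /=; lia.
  do 3![apply: leq_trans (cardU1 _ _) _; rewrite ltnS].
  by apply: leq_trans (cardU1 _ _) _; rewrite cards1.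
have ZN : {in Z, forall k, - k \in Z}.
  move=> k; rewrite !inE -!orbA => /or4P[|||/orP[]] /eqP->;
    by rewrite ?oppr0 ?opprK eqxx ?orbT.
have Z0 : 0 \in Z by rewrite !inE eqxx.
have sumU (V : nmodType) (D X : {set 'F_p}) (F : 'F_p -> V) :
    [disjoint D & Z] -> X \subset Z ->
    \sum_(i in D :|: X) F i = \sum_(i in D) F i + \sum_(i in X) F i.
  move=> DZ XZ; rewrite -bigU /=; last exact: disjointWr XZ DZ.
  by apply: eq_bigl => i; rewrite !inE.
have cardU (D X : {set 'F_p}) : [disjoint D & Z] -> X \subset Z ->
    (#|D :|: X| = #|D| + #|X|)%N.
  by move=> DZ XZ; rewrite -!sum1_card (sumU nat).
have [h_odd|h_even] := boolP (odd h).
- have /sigW[D /and3P[/'forall_implyP DN DZ /eqP D_card]] :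
      exists D : {set 'F_p}, [&& [forall k in D, - k \in D],
        [disjoint D & Z] & #|D| == (h - 3)./2.*2].
    by apply: symmetric_set_exists => //; lia.
  (* The 0 in [X] cancels the term [g k], leaving the pairs at distances 1 and 2. *)
  pose X : {set 'F_p} := [set 0; 1; -1].
  pose Y : {set 'F_p} := [set 2%:R; - 2%:R].
  have XZ : X \subset Z.
    by apply/subsetP=> k; rewrite !inE => /orP[/orP[]|] ->; rewrite ?orbT.
  have YZ : Y \subset Z.
    by apply/subsetP=> k; rewrite !inE => /orP[] ->; rewrite ?orbT.
  have sumX (V : nmodType) (F : 'F_p -> V) :
      \sum_(i in X) F i = F 0 + (F 1 + F (-1)).
    rewrite /X -setUA big_setU1 ?big_setU1 ?big_set1 ?inE //=.
    by rewrite ![0 == _]eq_sym oppr_eq0 (negPf n1).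
  have sumY (V : nmodType) (F : 'F_p -> V) :
      \sum_(i in Y) F i = F 2%:R + F (-2%:R).
    by rewrite /Y big_setU1 ?big_set1 ?inE.
  exists (D :|: X, D :|: Y); split => /=.
  + move=> k; rewrite !inE -!orbA => /or4P[/DN->||| ] // /eqP->;
      by rewrite ?oppr0 ?opprK eqxx ?orbT.
  + move=> k; rewrite !inE => /or3P[/DN->||] // /eqP->;
      by rewrite ?opprK eqxx ?orbT.
  + rewrite cardU // D_card -sum1_card (sumX nat).
    change ((h - 3)./2.*2 + (1 + (1 + 1)) = h)%N; lia.
  + rewrite cardU // D_card -sum1_card (sumY nat).
    change ((h - 3)./2.*2 + (1 + 1) = h.-1)%N; lia.
  move=> g g_ker; apply: (@second_difference_const p R g 2%:R 1).
  + by rewrite -(natr1 1%N) addrK.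
  + by rewrite natr1.
  move=> k; have := g_ker k.
  rewrite (sumU _ D X) // (sumU _ D Y) // sumX sumY addr0; lra.
- have /sigW[D /and3P[/'forall_implyP DN DZ /eqP D_card]] :
      exists D : {set 'F_p}, [&& [forall k in D, - k \in D],
        [disjoint D & Z] & #|D| == (h - 2)./2.*2].
    by apply: symmetric_set_exists => //; lia.
  (* Here 0 lies in the second set and doubles the term [g k]: this is the second difference
     equation with [b] = 0. *)
  pose X : {set 'F_p} := [set 1; -1].
  have XZ : X \subset Z.
    by apply/subsetP=> k; rewrite !inE => /orP[] ->; rewrite ?orbT.
  have YZ : [set 0] \subset Z by rewrite sub1set.
  have sumX (V : nmodType) (F : 'F_p -> V) : \sum_(i in X) F i = F 1 + F (-1).
    by rewrite /X big_setU1 ?big_set1 ?inE.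
  exists (D :|: X, D :|: [set 0]); split => /=.
  + move=> k; rewrite !inE => /or3P[/DN->||] // /eqP->;
      by rewrite ?opprK eqxx ?orbT.
  + move=> k; rewrite !inE => /orP[/DN->|] // /eqP->;
      by rewrite oppr0 eqxx ?orbT.
  + rewrite cardU // D_card -sum1_card (sumX nat).
    change ((h - 2)./2.*2 + (1 + 1) = h)%N; lia.
  + by rewrite cardU // D_card cards1; lia.
  move=> g g_ker; apply: (@second_difference_const p R g 1 0).
  + by rewrite subr0.
  + by rewrite addr0.
  move=> k; have := g_ker k.
  rewrite (sumU _ D X) // (sumU _ D [set 0]) // sumX big_set1 subr0 addr0; lra.
Qed.

(** A sigma type, so that a sequence of graphs can be defined by projection; the order 4p serves to
    tell the graphs apart. *)
Lemma cayley_nut_graph d : (4 <= d)%N -> ~~ odd d -> (d + 5 < p)%N ->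
  {G : sgraph |
    [/\ regular d G, cayley_graph G, nut_graph R G & #|G| = (4 * p)%N]}.
Proof.
move=> d4 d_even dp; have dE : d = d./2.*2 by lia.
have [||[S S'] [/= SN S'N S_card S'_card chi_ker]] := @connection_sets d./2;
  try lia.
exists (Cay (connection1 S S') (connectionV SN S'N)); split.
- suff -> : d = (#|S| + #|S'|).+1 by apply: regular_connection.
  by rewrite S_card S'_card; lia.
- exists (bool * bool * 'F_p)%type, (connection S S').
  exists (connection1 S S'), (connectionV SN S'N).
  by exists id; split => //; exists id.
- by apply: (nut_connection p_pr SN S'N _ _ S_card S'_card chi_ker); lia.
- by rewrite /= !card_prod card_bool card_Fp.
Qed.
End Existence.

Local Close Scope ring_scope.

Theorem theorem9 (R : realFieldType) (d : nat) (d_ge4 : 4 <= d)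
    (d_even : ~~ odd d) :
  exists G : nat -> sgraph,
    (forall n, [/\ regular d (G n), cayley_graph (G n) & nut_graph R (G n)]) /\
    (forall m n, m <> n -> ~ graph_iso (G m) (G n)).
Proof.
pose next m := s2val (prime_above m).
have next_gt m : m < next m := s2valP (prime_above m).
have next_pr m : prime (next m) := s2valP' (prime_above m).
(* The outer [next] makes [q 0] already a prime above [d + 5], which itself need not be prime. *)
pose q n := next (iter n next (d + 5)).
have q_mono : {homo q : m n / m < n}.
  by apply: homo_ltn (ltn_trans) _ => n; rewrite /q iterS next_gt.
have q_gt n : d + 5 < q n.
  case: n => [|n]; first exact: next_gt.
  exact: ltn_trans (next_gt _) (q_mono _ _ (ltn0Sn n)).
pose GP n := cayley_nut_graph (next_pr _ : prime (q n)) R d_ge4 d_even (q_gt n).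
exists (fun n => sval (GP n)); split=> [n|m n neq_mn [f [/bij_eq_card]]].
  by case: (svalP (GP n)).
case: (svalP (GP m)) => _ _ _ ->; case: (svalP (GP n)) => _ _ _ ->.
move/eqP; rewrite eqn_pmul2l // => /eqP eq_q.
by case: (ltngtP m n) => // /q_mono; lia.
Qed.
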